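(* A permutation $\pi$ satisfies $S^3(\pi)=\mathrm{id}$ (i.e. $\pi$ is West-$3$-stack-sortable) if and only if $\pi$ avoids all of the following ten patterns (each written as: underlying classical pattern; set of shaded boxes; decorated region, if any): 1. $23451$; no shaded boxes. 2. $24351$; shaded $\{(2,4),(2,5)\}$. 3. $32451$; shaded $\{(1,3),(1,4),(1,5)\}$. 4. $42351$; shaded $\{(1,4),(1,5),(2,4),(2,5)\}$. 5. $43251$; shaded $\{(1,4),(1,5),(2,3),(2,4),(2,5)\}$. 6. $34251$; shaded $\{(1,3),(1,4),(1,5),(2,4),(2,5)\}$. 7. $362451$; shaded $\{(0,4),(0,5),(1,3),(1,4),(1,5),(1,6),(2,4),(2,6)\}$; decorated region $\{(2,5)\}$. 8. $364251$; shaded $\{(0,4),(0,5),(1,3),(1,4),(1,5),(1,6),(2,4),(2,6),(3,4),(3,5),(3,6)\}$; decorated region $\{(2,5)\}$. 9. $7362451$; shaded $\{(1,4),(1,5),(1,6),(1,7),(2,3),(2,4),(2,5),(2,6),(2,7),(3,4),(3,6),(3,7)\}$; decorated region $\{(3,5)\}$. 10. $7364251$; shaded $\{(1,4),(1,5),(1,6),(1,7),(2,3),(2,4),(2,5),(2,6),(2,7),(3,4),(3,6),(3,7),(4,4),(4,5),(4,6),(4,7)\}$; decorated region $\{(3,5)\}$.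
   Context: Permutations are in one-line notation; $\mathrm{id}$ is the identity permutation. For a sequence $w$ of distinct integers, the stack-sort $S(w)$ is defined by $S(\varepsilon)=\varepsilon$ and $S(\alpha m\beta)=S(\alpha)S(\beta)m$ where $m$ is the largest entry of $w$ (equivalently: read $w$ left to right; before pushing an entry onto a stack, pop to the output all stack entries smaller than it; at the end pop the remaining stack). $S^3=S\circ S\circ S$. A permutation $\pi$ of length $n$ contains the classical pattern $p$ of length $k$ if there are positions $i_1<\dots<i_k$ with $\pi(i_1)\cdots\pi(i_k)$ order-isomorphic to $p$; these entries form an occurrence. For an occurrence with positions $i_1<\dots<i_k$ and values $v_1<\dots<v_k$, set $i_0=v_0=0$, $i_{k+1}=v_{k+1}=n+1$; for $0\le a,b\le k$ the box $(a,b)$ is the set of entries $\pi(x)$ with $i_a<x<i_{a+1}$ and $v_b<\pi(x)<v_{b+1}$. A pattern with shaded boxes $R$ and decorated region $D$ (sets of boxes) occurs in $\pi$ if there is an occurrence of the underlying classical pattern such that every box in $R$ contains no entry of $\pi$, and the entries of $\pi$ lying in the union of the boxes of $D$, read left to right, form a decreasing sequence (i.e. avoid the pattern $12$). $\pi$ avoids a pattern if it has no occurrence of it. *)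

(* Defs.v *)
(* Permutations of length n are sequences of naturals in
   one-line notation that are permutations of [:: 1; 2; ...; n]. Positions and
   values are 1-indexed as in the paper. *)
From mathcomp Require Import all_boot.
Set Implicit Arguments. Unset Strict Implicit. Unset Printing Implicit Defensive.

Definition is_perm (pi : seq nat) : bool := perm_eq pi (iota 1 (size pi)).

Definition idp (n : nat) : seq nat := iota 1 n.

(* Stack-sorting, by the stack algorithm. The stack is a seq whose head is the
   top. Before pushing x, pop (to the output) all stack entries smaller than x,
   i.e. pop while the top is smaller than x; at the end pop the whole stack. *)
Fixpoint stack_sort_aux (st w : seq nat) : seq nat :=
  match w with
  | [::] => st
  | x :: w' =>
      let k := find (fun y => x < y) st in
      take k st ++ stack_sort_aux (x :: drop k st) w'
  end.

Definition stack_sort (w : seq nat) : seq nat := stack_sort_aux [::] w.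

Definition S3 (w : seq nat) : seq nat := stack_sort (stack_sort (stack_sort w)).

Definition ent (pi : seq nat) (x : nat) : nat := nth 0 pi x.-1.

Definition occurrence (pi p idx : seq nat) : Prop :=
  [/\ size idx = size p,
      sorted ltn idx,
      all (fun i => (1 <= i) && (i <= size pi)) idx &
      forall a b, a < size p -> b < size p ->
        (ent pi (nth 0 idx a) < ent pi (nth 0 idx b)) = (nth 0 p a < nth 0 p b)].

Definition ipos (n : nat) (idx : seq nat) (a : nat) : nat :=
  if a == 0 then 0 else if a <= size idx then nth 0 idx a.-1 else n.+1.

Definition vpos (pi idx : seq nat) (b : nat) : nat :=
  let vs := sort leq [seq ent pi i | i <- idx] in
  if b == 0 then 0 else if b <= size vs then nth 0 vs b.-1 else (size pi).+1.

Definition in_box (pi idx : seq nat) (ab : nat * nat) (x : nat) : bool :=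
  let n := size pi in
  [&& ipos n idx ab.1 < x, x < ipos n idx ab.1.+1,
      vpos pi idx ab.2 < ent pi x & ent pi x < vpos pi idx ab.2.+1].

Definition region_entries (pi idx : seq nat) (D : seq (nat * nat)) : seq nat :=
  [seq ent pi x | x <- iota 1 (size pi) & has (fun ab => in_box pi idx ab x) D].

Definition avoids12 (s : seq nat) : bool := pairwise (fun u v => ~~ (u < v)) s.

Record dpattern := DPat { pat : seq nat; shaded : seq (nat * nat); decor : seq (nat * nat) }.

Definition occurs (P : dpattern) (pi : seq nat) : Prop :=
  exists idx : seq nat,
    [/\ occurrence pi (pat P) idx,
        (forall ab, ab \in shaded P ->
           forall x, 1 <= x <= size pi -> ~~ in_box pi idx ab x) &
        avoids12 (region_entries pi idx (decor P))].

Definition avoids (P : dpattern) (pi : seq nat) : Prop := ~ occurs P pi.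

Definition P1 := DPat [:: 2;3;4;5;1] [::] [::].
Definition P2 := DPat [:: 2;4;3;5;1] [:: (2,4);(2,5)] [::].
Definition P3 := DPat [:: 3;2;4;5;1] [:: (1,3);(1,4);(1,5)] [::].
Definition P4 := DPat [:: 4;2;3;5;1] [:: (1,4);(1,5);(2,4);(2,5)] [::].
Definition P5 := DPat [:: 4;3;2;5;1] [:: (1,4);(1,5);(2,3);(2,4);(2,5)] [::].
Definition P6 := DPat [:: 3;4;2;5;1] [:: (1,3);(1,4);(1,5);(2,4);(2,5)] [::].
Definition P7 := DPat [:: 3;6;2;4;5;1]
  [:: (0,4);(0,5);(1,3);(1,4);(1,5);(1,6);(2,4);(2,6)] [:: (2,5)].
Definition P8 := DPat [:: 3;6;4;2;5;1]
  [:: (0,4);(0,5);(1,3);(1,4);(1,5);(1,6);(2,4);(2,6);(3,4);(3,5);(3,6)] [:: (2,5)].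
Definition P9 := DPat [:: 7;3;6;2;4;5;1]
  [:: (1,4);(1,5);(1,6);(1,7);(2,3);(2,4);(2,5);(2,6);(2,7);(3,4);(3,6);(3,7)]
  [:: (3,5)].
Definition P10 := DPat [:: 7;3;6;4;2;5;1]
  [:: (1,4);(1,5);(1,6);(1,7);(2,3);(2,4);(2,5);(2,6);(2,7);(3,4);(3,6);(3,7);
      (4,4);(4,5);(4,6);(4,7)]
  [:: (3,5)].


Example ss_ex : stack_sort [:: 2;3;1] = [:: 2;1;3]. Proof. by []. Qed.
Example ss_ex2 : stack_sort [:: 3;1;2] = [:: 1;2;3]. Proof. by []. Qed.
Example ss_ex3 : stack_sort [:: 4;1;3;2;5] = [:: 1;2;3;4;5]. Proof. by []. Qed.

(* Main.v *)
(** Write [inv231 w v u] for "some z > v lies between v and u in w". For u < v, the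
    stack outputs v before u exactly when [inv231 w v u] holds. Applying this to the three
    passes, from the last one back to the first, shows that S^3(w) <> id iff w contains
    a < b < c < d with [inv231 w d a], not [inv231 w d c], and such that [inv231 w x b]
    implies [inv231 w x c] for all x > c (predicate [bad]).

    Let e > d lie between d and a. If nothing larger than c lies between c and b, the
    possible relative orders of b, c, d are the patterns P1 to P5. Otherwise the entries
    larger than c between c and b are decreasing, with first entry m: m < e gives P6,
    and m > e gives P7 to P10, according to whether some entry below e can play the role
    of d before b, and whether entries with value between c and m precede c (they are then
    hidden by a larger entry just before c). Conversely P1 to P5 are directly bad, and
    in P6 to P10 a violation of the last clause of [bad] exhibits P1 or P3. *)
Require Import Defs.
From mathcomp Require Import all_boot.
From mathcomp Require Import zify.
Set Implicit Arguments. Unset Strict Implicit. Unset Printing Implicit Defensive.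

(* [lia] chokes on the membership and quantified hypotheses. *)
Ltac arith :=
  repeat match goal with
  | H : forall _, _ |- _ => clear H
  | H : is_true (in_mem _ _) |- _ => clear H
  | H : is_true (~~ in_mem _ _) |- _ => clear H
  | H : is_true (uniq _) |- _ => clear H
  | H : is_true (perm_eq _ _) |- _ => clear H
  | H : is_true (all _ _) |- _ => clear H
  | H : is_true (orb _ _) |- _ => clear H
  end; lia.

(** * The recursion of stack-sorting at the largest entry *)

(** Entries at the bottom of the stack that exceed everything still to be read are never popped
    before the end, so they act as an inert suffix. *)
Lemma stack_sort_aux_cat (s1 s2 w : seq nat) :
  allrel (fun x y => x < y) w s2 ->
  stack_sort_aux (s1 ++ s2) w = stack_sort_aux s1 w ++ s2.
Proof.
elim: w s1 => [|x w IH] s1 //=; rewrite allrel_consl => /andP[xs2 ws2].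
have -> : find (fun y => x < y) (s1 ++ s2) = find (fun y => x < y) s1.
  rewrite find_cat; case: ifP => // /hasPn no.
  have -> : find (fun y => x < y) s2 = 0 by case: s2 xs2 {IH ws2 no} => //= y s2 /andP[->].
  rewrite addn0; apply/esym/hasNfind/hasPn => y ys; exact: no.
have le1 := find_size (fun y => x < y) s1.
rewrite takel_cat // drop_cat.
(* If [x] pops all of [s1], the new stack is [[:: x]] on top of [s2], which needs its own instance
   of the induction hypothesis. *)
move: le1; rewrite leq_eqVlt => /orP[/eqP ->|->]; last by rewrite -cat_cons IH // catA.
by rewrite ltnn subnn drop0 drop_size -[x :: s2]/([:: x] ++ s2) IH // catA.
Qed.

(** On arrival [m] exceeds the whole stack and flushes it; the run then continues with [m] alone on
    the stack. *)
Lemma stack_sort_aux_max (s al be : seq nat) (m : nat) :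
  all (fun x => x < m) (s ++ al) ->
  stack_sort_aux s (al ++ m :: be) = stack_sort_aux s al ++ stack_sort_aux [:: m] be.
Proof.
elim: al s => [|x al IH] s /=.
  rewrite cats0 => /allP sm.
  have -> : find (fun y => m < y) s = size s.
    by apply/hasNfind/hasPn => y /sm; rewrite -leqNgt; apply: ltnW.
  by rewrite take_size drop_size.
rewrite all_cat /= => /and3P[sm xm alm]; rewrite IH ?catA //= xm all_cat alm andbT.
by apply/allP => y /mem_drop ys; move/allP: sm; apply.
Qed.

(** This is the recursive definition of stack-sorting: [m] flushes what precedes it and then stays
    at the bottom until the end. *)
Lemma stack_sort_max (al be : seq nat) (m : nat) :
  all (fun x => x < m) al -> all (fun x => x < m) be ->
  stack_sort (al ++ m :: be) = stack_sort al ++ stack_sort be ++ [:: m].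
Proof.
move=> alm bem; rewrite /stack_sort stack_sort_aux_max //.
rewrite -[[:: m]]/([::] ++ [:: m]) stack_sort_aux_cat //.
by apply/allrelP => x y /(allP bem) xm; rewrite inE => /eqP ->.
Qed.

(** The induction principle that matches the recursion of [stack_sort_max]. *)
Lemma uniq_max_ind (P : seq nat -> Prop) :
  P [::] ->
  (forall (al : seq nat) (m : nat) (be : seq nat), uniq (al ++ m :: be) ->
     all (fun x => x < m) al -> all (fun x => x < m) be -> P al -> P be ->
     P (al ++ m :: be)) ->
  forall w : seq nat, uniq w -> P w.
Proof.
move=> P0 PS w; have [n] := ubnP (size w); elim: n w => // n IH w sz uw.
have [->//|/eqP w0] := eqVneq w [::].
have [m mw mmax] : exists2 m, m \in w & forall y, y \in w -> y <= m.
  have ex : exists i, i \in w by case: w w0 {sz uw} => // x w; exists x; rewrite mem_head.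
  have ub i : i \in w -> i <= \max_(j <- w) j by move=> iw; rewrite (big_rem i) //= leq_maxl.
  by case: (ex_maxnP ex ub) => m; exists m.
case/splitPr: mw mmax uw sz {w0} => al be mmax uw sz.
have lem y : y \in al ++ be -> y < m.
  move=> yin; rewrite ltn_neqAle mmax ?andbT; last first.
    by move: yin; rewrite !mem_cat inE => /orP[] ->; rewrite ?orbT.
  apply: contraTneq yin => ->; move: uw; rewrite -[m :: be]cat1s uniq_catCA /=.
  by case/andP.
move: (uw); rewrite cat_uniq /= => /and4P[ual _ _ ube].
move: sz; rewrite size_cat /= => sz.
have alm : all (fun x => x < m) al by apply/allP => x xa; rewrite lem // mem_cat xa.
have bem : all (fun x => x < m) be by apply/allP => x xa; rewrite lem // mem_cat xa orbT.
apply: PS => //; apply: IH => //; move: sz; rewrite addnS ltnS; apply: leq_trans.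
  exact: leq_addr.
exact: leq_addl.
Qed.

(** * Effect of one pass on the order of two entries *)

Definition inv231 (w : seq nat) (v u : nat) : bool :=
  has (fun z => [&& v < z, index v w < index z w & index z w < index u w]) w.

Lemma perm_stack_sort (w : seq nat) : uniq w -> perm_eq (stack_sort w) w.
Proof.
move: w; apply: uniq_max_ind => // al m be _ alm bem pal pbe.
rewrite stack_sort_max //; apply: perm_cat => //.
by rewrite perm_catC /= perm_cons.
Qed.

(* Restated with [size] at type [nat] instead of [Equality.sort nat], which [lia] would
   treat as a different term. *)
Lemma index_memN (s : seq nat) (x : nat) : (index x s < size s) = (x \in s).
Proof. exact: index_mem. Qed.

Lemma index_catN (s t : seq nat) (x : nat) :
  index x (s ++ t) = if x \in s then index x s else size s + index x t.
Proof. exact: index_cat. Qed.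

(** Split at the maximum [m]. If [u] and [v] lie on the same side of [m], any witness lies between
    them, hence on that side, and induction applies. If [m] separates them, their order is kept, and
    [m] is a witness exactly when [v] comes first. If [v] is [m], it is output last and has no
    larger witness. *)
Lemma index_ltn_stack_sort (w : seq nat) : uniq w -> forall u v : nat,
  u \in w -> v \in w -> u < v ->
  (index v (stack_sort w) < index u (stack_sort w)) = inv231 w v u.
Proof.
move: w; apply: uniq_max_ind => // al m be uw alm bem IHal IHbe u v.
move: (uw); rewrite cat_uniq /= => /and4P[ual /norP[mal /hasPn dis] mbe ube].
have pal := perm_stack_sort ual; have pbe := perm_stack_sort ube.
have mS x : (x \in stack_sort al) = (x \in al) by rewrite (perm_mem pal).
have mS' x : (x \in stack_sort be) = (x \in be) by rewrite (perm_mem pbe).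
have sS := perm_size pal; have sS' := perm_size pbe.
have iS := index_memN (stack_sort al); have iS' := index_memN (stack_sort be).
have ial := index_memN al.
have be_al x : x \in be -> x \in al = false by move=> /dis/negbTE.
have ltal := allP alm; have ltbe := allP bem.
rewrite stack_sort_max // !index_catN !mS !mS' !mem_cat !inE /=.
move=> hu hv uv.
have um : u < m.
  clear hu; case/or3P: hv => [/ltal|/eqP|/ltbe] /=; arith.
have [ual'|unal] := boolP (u \in al); have [val'|vnal] := boolP (v \in al).
- rewrite IHal //; apply/hasP/hasP => -[z zw /and3P[vz z1 z2]].
    exists z; first by rewrite mem_cat zw.
    by rewrite !index_catN ual' val' zw vz z1.
  move: z1 z2; rewrite !index_catN ual' val'; case: (boolP (z \in al)) => zal.
    by move=> z1 z2; exists z => //; rewrite vz z1.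
  by have := ial u; rewrite ual'; arith.
- have := iS u; rewrite mS ual' => iu; apply/idP/hasP => [|[z _ /and3P[_ z1 z2]]].
    by case: ifP => _ ?; exfalso; arith.
  have := ltn_trans z1 z2; rewrite !index_catN ual' (negbTE vnal).
  by have := ial u; rewrite ual'; arith.
- have iv := iS v; rewrite mS val' in iv; apply/idP/hasP => _.
    (* Since [u < m] and [u] is not in [al], it lies after [m]. *)
    exists m; first by rewrite mem_cat mem_head orbT.
    rewrite !index_catN val' (negbTE unal) (negbTE mal) /= eqxx.
    rewrite ltal //=; have := ial v; rewrite val'; case: eqP um => [->|_ _]; last by arith.
    by rewrite ltnn.
  by case: ifP => _; arith.
- have ube' : u \in be by move: hu; rewrite (negbTE unal) /=; case: eqP um => // ->; rewrite ltnn.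
  rewrite ube'; case: (eqVneq v m) => [vm|vm].
    have -> : v \in be = false by rewrite vm (negbTE mbe).
    have := iS' u; rewrite mS' ube' => iu; apply/idP/hasP => [?|[z]].
      by exfalso; arith.
    rewrite mem_cat inE vm => /or3P[/ltal|/eqP|/ltbe] /= ? /and3P[]; arith.
  have vbe : v \in be by move: hv; rewrite (negbTE vnal) (negbTE vm).
  rewrite vbe ltn_add2l IHbe //.
  have ixE x : x \in be -> index x (al ++ m :: be) = size al + (index x be).+1.
    move=> xbe; rewrite index_catN be_al //=; case: eqP => // mx.
    by move: mbe; rewrite mx xbe.
  apply/hasP/hasP => -[z zw].
    by move=> h; exists z; rewrite ?mem_cat ?inE ?zw ?orbT // !ixE //; arith.
  rewrite (ixE v) // (ixE u) // => /and3P[vz z1 z2].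
  have zbe : z \in be.
    move: zw z1; rewrite mem_cat inE => /or3P[h|/eqP ->|//].
      by rewrite index_catN h; move: (ial z); rewrite h => ? ?; exfalso; arith.
    by rewrite index_catN (negbTE mal) /= eqxx => ?; exfalso; arith.
  by exists z => //; move: z1 z2; rewrite ixE //; arith.
Qed.

Lemma index_inj_in (w : seq nat) (u v : nat) :
  u \in w -> index u w = index v w -> u = v.
Proof. by move=> uw e; rewrite -(nth_index 0 uw) e nth_index // -index_mem -e index_mem. Qed.

Lemma index_neq (w : seq nat) (u v : nat) :
  u \in w -> u != v -> index u w != index v w.
Proof. by move=> uw; apply: contraNneq => e; apply/eqP/(index_inj_in uw). Qed.

Lemma index_ltn_stack_sortN (w : seq nat) (u v : nat) : uniq w ->
  u \in w -> v \in w -> u < v ->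
  (index u (stack_sort w) < index v (stack_sort w)) = ~~ inv231 w v u.
Proof.
move=> uw uu vw uv; rewrite -index_ltn_stack_sort // -leqNgt [RHS]leq_eqVlt.
have := @index_neq (stack_sort w) u v; rewrite (perm_mem (perm_stack_sort uw)).
by move=> /(_ uu) h; rewrite (negbTE (h _)) // neq_ltn uv.
Qed.

(** * Three passes: failure to sort as the predicate [bad] *)

Lemma sorted_index (n : nat) (s : seq nat) : perm_eq s (iota 1 n) ->
  s = iota 1 n <-> {in s &, forall u v, u < v -> index u s < index v s}.
Proof.
move=> ps; have us : uniq s by rewrite (perm_uniq ps) iota_uniq.
split=> [-> u v|h].
  rewrite !mem_iota => hu hv uv.
  have ix x : 1 <= x < 1 + n -> index x (iota 1 n) = x.-1.
    by move=> hx; rewrite -{1}[x](_ : nth 0 (iota 1 n) x.-1 = x) ?index_uniq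
      ?iota_uniq ?size_iota ?nth_iota //; lia.
  by rewrite !ix //; lia.
apply: (@sorted_eq _ leq) => //; [exact: leq_trans|exact: anti_leq| |exact: iota_sorted].
apply/(sortedP 0) => i si; rewrite leqNgt; apply/negP => lt.
have := h _ _ (mem_nth 0 si) (mem_nth 0 (ltnW si)) lt.
by rewrite !index_uniq ?(ltnW si) //; lia.
Qed.

Definition bad (w : seq nat) : Prop :=
  exists a b c d, [/\ [/\ a \in w, b \in w, c \in w & d \in w],
    [/\ a < b, b < c & c < d], inv231 w d a, ~~ inv231 w d c &
    {in w, forall x, c < x -> inv231 w x b -> inv231 w x c}].

(** Since [u < v < z], the order of [z] relative to both [v] and [u] after the pass is known from
    the order lemma, so a 231 pattern after the pass is expressed before it. *)
Lemma inv231_stack_sort (w : seq nat) (v u : nat) : uniq w -> u \in w -> v \in w -> u < v ->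
  inv231 (stack_sort w) v u = has (fun z => [&& v < z, ~~ inv231 w z v & inv231 w z u]) w.
Proof.
move=> uw uin vin uv; rewrite /inv231 (perm_has _ (perm_stack_sort uw)).
apply: eq_in_has => z zw /=; case: ltnP => //= vz.
by rewrite index_ltn_stack_sortN // index_ltn_stack_sort // (ltn_trans uv).
Qed.

Lemma S3_not_id (w : seq nat) : is_perm w -> S3 w <> idp (size w) <-> bad w.
Proof.
rewrite /is_perm => pw.
have uw : uniq w by rewrite (perm_uniq pw) iota_uniq.
have p1 := perm_stack_sort uw; have u1 := uw; rewrite -(perm_uniq p1) in u1.
have p2 := perm_stack_sort u1; have u2 := u1; rewrite -(perm_uniq p2) in u2.
have p3 := perm_stack_sort u2; have u3 := u2; rewrite -(perm_uniq p3) in u3.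
have m1 := perm_mem p1; have m2 x : x \in _ = (x \in w) := etrans (perm_mem p2 x) (m1 x).
have m3 x : x \in _ = (x \in w) := etrans (perm_mem p3 x) (m2 x).
have pS : perm_eq (S3 w) (iota 1 (size w)).
  by apply: perm_trans pw; apply: perm_trans p1; apply: perm_trans p2.
rewrite /idp (sorted_index pS) /S3.
have key a c : a \in w -> c \in w -> a < c ->
    (index a (stack_sort (stack_sort (stack_sort w)))
      < index c (stack_sort (stack_sort (stack_sort w)))) =
    ~~ has (fun b => [&& c < b, ~~ inv231 (stack_sort w) b c & inv231 (stack_sort w) b a]) w.
  move=> aw cw ac; rewrite index_ltn_stack_sortN ?m2 // inv231_stack_sort ?m1 //.
  by rewrite (perm_has _ p1).
split=> [nh|[a [b [c [d [[aw bw cw dw] [ab bc cd] da dc K]]]]] h].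
  (* Failure to be sorted is written with nested boolean [has], so that a double negation yields
     witnesses without classical axioms. *)
  suff : has (fun a => has (fun b => (a < b) &&
     has (fun c => [&& b < c, ~~ inv231 (stack_sort w) c b & inv231 (stack_sort w) c a]) w) w) w.
    case/hasP=> a aw /hasP[b bw /andP[ab /hasP[c cw /and3P[bc ncb]]]].
    rewrite inv231_stack_sort // ?(ltn_trans ab) // => /hasP[d dw /and3P[cd dc da]].
    (* The negated inner [has] of the second pass is, after contraposition, the last clause of
       [bad]. *)
    exists a, b, c, d; split=> // x xw cx xb.
    move: ncb; rewrite inv231_stack_sort // => /hasPn/(_ x xw); rewrite cx xb /= andbT.
    by rewrite negbK.
  apply/negPn/negP => /hasPn no; apply: nh => a b; rewrite !m3 => aw bw ab.
  by rewrite key //; have /hasPn/(_ b bw) := no a aw; rewrite ab.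
have := h a b; rewrite !m3 key // => /(_ aw bw ab) /hasPn/(_ c cw).
rewrite bc /= !inv231_stack_sort // ?(ltn_trans ab) // negb_and negbK.
case/orP=> [/hasP[x xw]|/hasPn/(_ d dw)].
  by case/and3P=> cx nx xb; move: nx; rewrite K.
by rewrite cd dc da.
Qed.

(** * Pattern occurrences described by values *)

(* Occurrences are handled through their values; positions are 1-based, as in [ent]. *)
Definition pos (w : seq nat) (x : nat) : nat := (index x w).+1.

(* The values of the occurrence vs of p, in increasing order. *)
Definition vsort (p vs : seq nat) : seq nat :=
  [seq nth 0 vs (index i p) | i <- iota 1 (size p)].

(** The leading 0 and the default value [n] of [nth] are the two sentinels 0 and [(size w).+1] that
    bound the outer boxes. *)
Definition vbox (w p vs : seq nat) (ab : nat * nat) (x : nat) : bool :=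
  let ps := 0 :: [seq pos w v | v <- vs] in let bs := 0 :: vsort p vs in
  let n := (size w).+1 in
  [&& nth n ps ab.1 < pos w x, pos w x < nth n ps ab.1.+1,
      nth n bs ab.2 < x & x < nth n bs ab.2.+1].

(** Order-isomorphism is replaced by the monotonicity of [vsort], so that for a concrete pattern
    everything unfolds to comparisons of values and of positions. *)
Definition vocc (P : dpattern) (w vs : seq nat) : Prop :=
  [/\ size vs = size (pat P) /\ all (fun v => v \in w) vs,
      sorted ltn [seq pos w v | v <- vs], sorted ltn (vsort (pat P) vs),
      {in w, forall x, all (fun ab => ~~ vbox w (pat P) vs ab x) (shaded P)} &
      {in w &, forall x y, has (fun ab => vbox w (pat P) vs ab x) (decor P) ->
         has (fun ab => vbox w (pat P) vs ab y) (decor P) -> pos w x < pos w y -> y <= x}].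

Lemma iposE (n : nat) (idx : seq nat) (a : nat) : ipos n idx a = nth n.+1 (0 :: idx) a.
Proof.
case: a => [|a] //=; rewrite /ipos /=; case: ifP => h; first exact: set_nth_default.
by rewrite nth_default // leqNgt h.
Qed.

Lemma is_perm_bounds (p : seq nat) (x : nat) : is_perm p -> x \in p -> 1 <= x <= size p.
Proof. by move=> pp; rewrite (perm_mem pp) mem_iota add1n ltnS. Qed.

(** The indices of 1, 2, ... in [p] form the inverse permutation of [p], shifted to start at 0. *)
Lemma perm_vsort (p vs : seq nat) : is_perm p -> size vs = size p -> perm_eq (vsort p vs) vs.
Proof.
move=> pp sz; have up : uniq p by rewrite (perm_uniq pp) iota_uniq.
rewrite /vsort map_comp.
suff h : perm_eq [seq index i p | i <- iota 1 (size p)] (iota 0 (size vs)).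
  by apply: perm_trans (perm_map _ h) _; rewrite map_nth_iota0 // take_size.
have -> : iota 0 (size vs) = [seq index i p | i <- p].
  apply: (@eq_from_nth _ 0) => [|i]; rewrite ?size_map ?size_iota // => ilt.
  by rewrite nth_iota // (nth_map 0) -?sz // index_uniq -?sz.
by apply: perm_map; rewrite perm_sym.
Qed.

Lemma sort_vsort (p vs : seq nat) : is_perm p -> size vs = size p ->
  sorted ltn (vsort p vs) -> sort leq vs = vsort p vs.
Proof.
move=> pp sz ss; apply: (@sorted_eq _ leq) => //.
- exact: leq_trans.
- exact: anti_leq.
- exact: sort_sorted leq_total _.
- by apply: sub_sorted ss => x y; apply: ltnW.
by rewrite perm_sort perm_sym perm_vsort.
Qed.

Lemma pairwise_filter_index (r : rel nat) (Q : pred nat) (s : seq nat) : uniq s ->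
  pairwise r (filter Q s) <->
  {in s &, forall x y, Q x -> Q y -> index x s < index y s -> r x y}.
Proof.
elim: s => [|z s IH] //= /andP[zs us].
have zN x : x \in s -> (z == x) = false by move=> xs; case: eqP zs => // ->; rewrite xs.
split=> [h x y|h].
  rewrite !inE; case: (eqVneq x z) => [->|xz] /=; case: (eqVneq y z) => [->|yz] /= xs ys Qx Qy.
  - by rewrite ltnn.
  - move=> _; move: h; rewrite Qx /= => /andP[/allP h _]; apply: h.
    by rewrite mem_filter Qy.
  - by [].
  - rewrite ltnS => lt.
    have {}h : pairwise r [seq x <- s | Q x] by move: h; case: ifP => // _ /andP[].
    by have /IH := h; apply.
have {}IH : pairwise r [seq x <- s | Q x].
  apply/IH => // x y xs ys Qx Qy lt.
  by apply: h; rewrite ?inE ?xs ?ys ?orbT // !zN.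
case: ifP => //= Qz; rewrite IH andbT; apply/allP => y; rewrite mem_filter => /andP[Qy ys].
apply: h; rewrite ?inE ?eqxx ?ys ?orbT //.
by rewrite zN.
Qed.

(** On valid positions and entries, [ent w] and [pos w] are mutually inverse, which turns a list of
    positions into a list of values and back. *)
Lemma occursP (P : dpattern) (w : seq nat) : is_perm w -> is_perm (pat P) ->
  occurs P w <-> exists vs, vocc P w vs.
Proof.
move=> pw pp; have uw : uniq w by rewrite (perm_uniq pw) iota_uniq.
have up : uniq (pat P) by rewrite (perm_uniq pp) iota_uniq.
have entK x : x \in w -> ent w (pos w x) = x by move=> xw; rewrite /ent /= nth_index.
have posK i : 1 <= i <= size w -> pos w (ent w i) = i.
  by case: i => // i /= h; rewrite /pos /ent /= index_uniq.
have posP x : x \in w -> 1 <= pos w x <= size w by rewrite /pos index_mem.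
have entP i : 1 <= i <= size w -> ent w i \in w.
  by case: i => // i /= h; rewrite /ent mem_nth.
have boxE vs ab x : all (fun v => v \in w) vs -> size vs = size (pat P) ->
    sorted ltn (vsort (pat P) vs) -> x \in w ->
    in_box w [seq pos w v | v <- vs] ab (pos w x) = vbox w (pat P) vs ab x.
  move=> aw sz ss xw; rewrite /in_box /vbox -!iposE entK //.
  rewrite -!(sort_vsort pp sz ss) /vpos -map_comp.
  suff -> : [seq (ent w \o pos w) i | i <- vs] = vs by [].
  by rewrite -[RHS]map_id; apply/eq_in_map => v /(allP aw) /entK.
have regE vs : all (fun v => v \in w) vs -> size vs = size (pat P) ->
    sorted ltn (vsort (pat P) vs) ->
    region_entries w [seq pos w v | v <- vs] (decor P) =
    [seq x <- w | has (fun ab => vbox w (pat P) vs ab x) (decor P)].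
  move=> aw sz ss.
  (* Only the filtered copy of [w] is rewritten as the list of entries at positions 1 to [size w],
     the form used by [region_entries]. *)
  have {4}-> : w = [seq ent w i | i <- iota 1 (size w)].
    apply: (@eq_from_nth _ 0) => [|i ilt]; rewrite ?size_map ?size_iota //.
    by rewrite (nth_map 0) ?size_iota // nth_iota.
  rewrite filter_map; congr map; apply/eq_in_filter => i; rewrite mem_iota => ib.
  have {}ib : 1 <= i <= size w by lia.
  by apply: eq_has => ab; rewrite -boxE ?posK // entP.
have decE vs : avoids12 [seq x <- w | has (fun ab => vbox w (pat P) vs ab x) (decor P)] <->
    {in w &, forall x y, has (fun ab => vbox w (pat P) vs ab x) (decor P) ->
         has (fun ab => vbox w (pat P) vs ab y) (decor P) -> pos w x < pos w y -> y <= x}.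
  rewrite /avoids12 pairwise_filter_index //; split=> h x y xw yw Qx Qy lt.
    by rewrite leqNgt; apply: h.
  by rewrite -leqNgt; apply: h.
split=> [[idx [[sz si ai iso] sh dec]]|[vs [[sz aw] si ss sh dec]]].
  have idxE : idx = [seq pos w v | v <- [seq ent w i | i <- idx]].
    rewrite -map_comp -[LHS]map_id; apply/eq_in_map => i ii /=.
    by rewrite posK // (allP ai).
  set vs := [seq ent w i | i <- idx] in idxE.
  have szv : size vs = size (pat P) by rewrite size_map.
  have aw : all (fun v => v \in w) vs.
    by rewrite all_map; apply/allP => i ii /=; rewrite entP // (allP ai).
  have ss : sorted ltn (vsort (pat P) vs).
    apply/(sortedP 0) => i; rewrite size_map size_iota => ik.
    have ix j : j < size (pat P) -> index (1 + j) (pat P) < size (pat P).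
      by move=> jk; rewrite index_mem (perm_mem pp) mem_iota; lia.
    have ik' := ltnW ik.
    rewrite !(nth_map 0) ?size_iota ?nth_iota ?sz ?ix //=.
    by rewrite iso ?ix // !nth_index -?index_mem ?ix //; lia.
  exists vs; split=> //.
  - by rewrite -idxE.
  - move=> x xw; apply/allP => ab abs; rewrite -boxE // -idxE; apply: sh => //.
    exact: posP.
  - by apply/decE; rewrite -regE // -idxE.
exists [seq pos w v | v <- vs]; split.
- split=> //; first by rewrite size_map.
    by rewrite all_map; apply/allP => v /(allP aw) /posP.
  have vm a : a < size (pat P) -> 1 <= nth 0 (pat P) a <= size (pat P).
    by move=> ak; apply: is_perm_bounds => //; apply: mem_nth.
  (* Pattern values start at 1 but indices in [vsort] at 0, hence the predecessor. *)
  have vE a : a < size (pat P) -> ent w (nth 0 [seq pos w v | v <- vs] a) =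
      nth 0 (vsort (pat P) vs) (nth 0 (pat P) a).-1.
    move=> ak; rewrite (nth_map 0) ?sz // entK; last by rewrite (allP aw) // mem_nth ?sz.
    have bd := vm _ ak.
    have bd1 : (nth 0 (pat P) a).-1 < size (pat P) by lia.
    rewrite (nth_map 0) ?size_iota ?nth_iota //.
    by rewrite add1n prednK ?index_uniq //; lia.
  have mono i j : i < j -> j < size (pat P) ->
      nth 0 (vsort (pat P) vs) i < nth 0 (vsort (pat P) vs) j.
    move=> ij jk; apply: (sorted_ltn_nth ltn_trans 0 ss) => //;
    by rewrite inE size_map size_iota //; lia.
  move=> a b ak bk; rewrite !vE //; have := vm a ak; have := vm b bk.
  case: (ltngtP (nth 0 (pat P) a) (nth 0 (pat P) b)) => [lt|gt|->] hb ha.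
  - by rewrite mono //; lia.
  - by apply/negbTE; rewrite -leqNgt ltnW // mono //; lia.
  - by rewrite ltnn.
- move=> ab abs x xb; rewrite -[x]posK // boxE // ?entP //.
  by have /allP := sh _ (entP _ xb); apply.
- by rewrite regE //; apply/decE.
Qed.

(** * Sufficient conditions for [bad] *)

Lemma inv231P (w : seq nat) (v u : nat) :
  reflect (exists z, [/\ z \in w, v < z, pos w v < pos w z & pos w z < pos w u]) (inv231 w v u).
Proof.
apply: (iffP hasP) => [[z zw /and3P[]]|[z [zw vz z1 z2]]]; first by exists z.
by exists z => //; apply/and3P.
Qed.

Lemma inv231Pn (w : seq nat) (v u : nat) :
  reflect {in w, forall z, ~~ [&& v < z, pos w v < pos w z & pos w z < pos w u]} (~~ inv231 w v u).
Proof. exact: hasPn. Qed.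

Lemma inv231_before (w : seq nat) (v u : nat) : pos w u <= pos w v -> ~~ inv231 w v u.
Proof. by move=> uv; apply/inv231Pn => z _; arith. Qed.

Lemma pos_total (w : seq nat) (u v : nat) :
  u \in w -> u < v -> pos w u < pos w v \/ pos w v < pos w u.
Proof.
move=> uw uv; case: (ltngtP (pos w u) (pos w v)) => [| |[e]]; [by left|by right|].
by move: uv; rewrite (index_inj_in uw e) ltnn.
Qed.

(** For the last clause of [bad], let [z > x > c] lie between [x] and [b]. It cannot lie between [c]
    and [b], so it precedes [c] and witnesses [inv231 w x c]. *)
Lemma bad_chain (w : seq nat) (a b c d e : nat) :
  a \in w -> b \in w -> c \in w -> d \in w -> e \in w ->
  [/\ a < b, b < c, c < d & d < e] -> pos w d < pos w e -> pos w e < pos w a ->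
  ~~ inv231 w d c -> ~~ inv231 w c b -> bad w.
Proof.
move=> aw bw cw dw ew [ab bc cd de] pde pea dc cb; exists a, b, c, d; split=> //.
  by apply/inv231P; exists e.
move=> x xw cx /inv231P[z [zw xz p1 p2]].
have /inv231Pn/(_ z zw) zN := cb; apply/inv231P; exists z; split=> //.
by case: (pos_total cw (ltn_trans cx xz)) => ?; arith.
Qed.

Lemma bad_increasing (w : seq nat) (a b c d e : nat) :
  a \in w -> b \in w -> c \in w -> d \in w -> e \in w ->
  [&& a < b, b < c, c < d & d < e] ->
  [&& pos w b < pos w c, pos w c < pos w d, pos w d < pos w e & pos w e < pos w a] -> bad w.
Proof.
move=> aw bw cw dw ew /and4P[ab bc cd de] /and4P[p1 p2 p3 p4].
by apply: (@bad_chain w a b c d e) => //; apply: inv231_before; apply: ltnW.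
Qed.

(* If the last clause of [bad] fails for x > c, then x lies after c, which is hypothesis
   H1, or before c, and then (x, c, d, e, a) is an occurrence of P3. *)
Lemma bad_fallback (w : seq nat) (a b c d e : nat) :
  a \in w -> b \in w -> c \in w -> d \in w -> e \in w ->
  [/\ a < b, b < c, c < d & d < e] ->
  pos w c < pos w d -> pos w d < pos w e -> pos w e < pos w a ->
  (forall x z, x \in w -> z \in w -> c < x -> x < z ->
     pos w c < pos w x -> pos w x < pos w z -> pos w z < pos w b -> bad w) ->
  (forall x z, x \in w -> z \in w -> c < x -> x < z ->
     pos w x < pos w c -> pos w c < pos w z -> pos w z < pos w b ->
     ~~ inv231 w x c -> x < d) ->
  bad w.
Proof.
move=> aw bw cw dw ew [ab bc cd de] pcd pde pea H1 H2.
have [/hasP[x xw /and3P[cx /inv231P[z [zw xz p1 p2]] nxc]]|/hasPn no] :=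
  boolP (has (fun x => [&& c < x, inv231 w x b & ~~ inv231 w x c]) w); last first.
  exists a, b, c, d; split=> //; first by apply/inv231P; exists e.
    by apply: inv231_before; arith.
  by move=> x xw cx xb; have := no x xw; rewrite cx xb negbK.
case: (pos_total cw cx) => [cx'|xc]; first exact: (H1 x z).
have pcz : pos w c < pos w z.
  have /inv231Pn/(_ z zw) zN := nxc; case: (pos_total cw (ltn_trans cx xz)) => ?; arith.
have xd := H2 x z xw zw cx xz xc pcz p2 nxc.
(* Here [c] and [x] take the roles of [b] and [c], and [nxc] is the last hypothesis. *)
apply: (@bad_chain w a c x d e) => //; first by split=> //; arith.
by apply: inv231_before; arith.
Qed.

(** Together with [pos_eq], this gives [lia], for which [pos w x] is opaque, the link between equal
    values and equal positions. *)
Lemma eq_pos (w : seq nat) (v x : nat) : (x != v) || (pos w x == pos w v).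
Proof. by case: eqVneq => // ->; rewrite eqxx. Qed.

Lemma pos_eq (w : seq nat) (v x : nat) : x \in w -> (pos w x != pos w v) || (x == v).
Proof. by move=> xw; case: (pos w x =P pos w v) => //= -[/(index_inj_in xw) ->]. Qed.

Ltac open_pattern pw P :=
  case/(occursP pw (isT : is_perm (pat P))); rewrite /vocc /vbox /vsort /ltn.

Ltac split_ands := repeat match goal with H : is_true (_ && _) |- _ => case/andP: H => ? ? end.

(** Resolving the known comparisons first keeps the box conditions small for [lia]. *)
Ltac decide_ltn :=
  repeat match goal with
  | H : is_true (?x < ?y) |- context [?x < ?y] => rewrite H
  | H : is_true (?x < ?y) |- context [?y < ?x] => rewrite (ltnNge y x) (ltnW H)
  end => /=.

(** * Each of the ten patterns implies [bad] *)

Lemma occurs_bad1 (w : seq nat) : is_perm w -> occurs P1 w -> bad w.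
Proof.
move=> pw; open_pattern pw P1 => -[|b [|c [|d [|e [|a [|? ?]]]]]] /= [[]] // _.
case/and5P=> bw cw dw ew /andP[aw _] pp vv _ _.
by apply: (@bad_increasing w a b c d e) => //; arith.
Qed.

(** The shading says that nothing above [d] lies between [d] and [c], which is [~~ inv231 w d c]. *)
Lemma occurs_bad2 (w : seq nat) : is_perm w -> occurs P2 w -> bad w.
Proof.
move=> pw; open_pattern pw P2 => -[|b [|d [|c [|e [|a [|? ?]]]]]] /= [[]] // _.
case/and5P=> bw dw cw ew /andP[aw _] pp vv sh _.
apply: (@bad_chain w a b c d e) => //; first (by split; arith); try arith.
  (* The bound on [x] puts it below the top sentinel. Boxes are open, so [x = e] lies in none of
     them and is excluded by its position. *)
  apply/inv231Pn => x xw; have := sh x xw; have := is_perm_bounds pw xw.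
  by have := eq_pos w e x; arith.
by apply: inv231_before; arith.
Qed.

Lemma occurs_bad3 (w : seq nat) : is_perm w -> occurs P3 w -> bad w.
Proof.
move=> pw; open_pattern pw P3 => -[|c [|b [|d [|e [|a [|? ?]]]]]] /= [[]] // _.
case/and5P=> cw bw dw ew /andP[aw _] pp vv sh _.
apply: (@bad_chain w a b c d e) => //; first (by split; arith); try arith.
  by apply: inv231_before; arith.
apply/inv231Pn => x xw; have := sh x xw; have := is_perm_bounds pw xw.
by have := eq_pos w d x; have := eq_pos w e x; arith.
Qed.

Lemma occurs_bad4 (w : seq nat) : is_perm w -> occurs P4 w -> bad w.
Proof.
move=> pw; open_pattern pw P4 => -[|d [|b [|c [|e [|a [|? ?]]]]]] /= [[]] // _.
case/and5P=> dw bw cw ew /andP[aw _] pp vv sh _.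
apply: (@bad_chain w a b c d e) => //; first (by split; arith); try arith.
  apply/inv231Pn => x xw; have := sh x xw; have := is_perm_bounds pw xw.
  (* An entry at the position of [b] lies in neither column; it is [b], which is smaller than
     [d]. *)
  by have := eq_pos w e x; have := pos_eq b xw; arith.
by apply: inv231_before; arith.
Qed.

Lemma occurs_bad5 (w : seq nat) : is_perm w -> occurs P5 w -> bad w.
Proof.
move=> pw; open_pattern pw P5 => -[|d [|c [|b [|e [|a [|? ?]]]]]] /= [[]] // _.
case/and5P=> dw cw bw ew /andP[aw _] pp vv sh _.
apply: (@bad_chain w a b c d e) => //; first (by split; arith); try arith;
  apply/inv231Pn => x xw; have := sh x xw; have := is_perm_bounds pw xw;
  by have := eq_pos w d x; have := eq_pos w e x; arith.
Qed.

(** Here [m] plays the role of [d]. It is the largest entry between [c] and [b], so an ascent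
    [x < z] above [c] there gives [P1] as [c], [x], [z], [e], [a]. *)
Lemma occurs_bad6 (w : seq nat) : is_perm w -> occurs P6 w -> bad w.
Proof.
move=> pw; open_pattern pw P6 => -[|c [|m [|b [|e [|a [|? ?]]]]]] /= [[]] // _.
case/and5P=> cw mw bw ew /andP[aw _] pp vv sh _.
have zm z : z \in w -> pos w c < pos w z -> pos w z < pos w b -> z <= m.
  move=> zw; have := sh z zw; have := is_perm_bounds pw zw.
  by have := eq_pos w e z; have := pos_eq m zw; arith.
apply: (@bad_fallback w a b c m e) => //; first (by split; arith); try arith.
  move=> x z xw zw cx xz p1 p2 p3; have zle : z <= m by apply: zm => //; arith.
  by apply: (@bad_increasing w a c x z e) => //; arith.
by move=> x z xw zw cx xz p1 p2 p3 _; apply: leq_trans xz (zm z zw _ _); arith.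
Qed.


(** An ascent [x < z] above [c] between [c] and [b] gives [P1] with [c], [x], [d], [e], [a] if
    [x < d]; otherwise both entries lie in the decorated box, which forbids it. The boxes of column
    0 force [x < d] for entries before [c] with value between [c] and [m]. *)
Lemma occurs_bad7 (w : seq nat) : is_perm w -> occurs P7 w -> bad w.
Proof.
move=> pw; open_pattern pw P7 => -[|c [|m [|b [|d [|e [|a [|? ?]]]]]]] /= [[]] // _.
case/and5P=> cw mw bw dw /and3P[ew aw _] pp vv sh dec.
split_ands.
have mfirst z : z \in w -> pos w c < pos w z -> pos w z < pos w m -> z <= c.
  move=> zw p1 p2; rewrite leqNgt; apply/negP => cz.
  have ? : pos w z < pos w b by arith.
  have := sh z zw; have := is_perm_bounds pw zw; decide_ltn; 
  by have := eq_pos w d z; have := eq_pos w e z; have := eq_pos w m z; arith.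
have mid z : z \in w -> pos w m < pos w z -> pos w z < pos w b ->
    (z < m) && ((z <= d) || (e < z)).
  move=> zw p1 p2.
  have ? : pos w c < pos w z by arith.
  have := sh z zw; have := is_perm_bounds pw zw; decide_ltn; 
  by have := eq_pos w d z; have := eq_pos w e z; have := eq_pos w m z; arith.
have zm z : z \in w -> pos w c < pos w z -> pos w z < pos w b -> c < z -> z <= m.
  move=> zw p1 p2 cz; case: (ltngtP (pos w z) (pos w m)) => [p3|p3|[/(index_inj_in zw)->]//].
    by have := mfirst z zw p1 p3; arith.
  by have /andP[/ltnW] := mid z zw p3 p2.
apply: (@bad_fallback w a b c d e) => //; try arith.
  move=> x z xw zw cx xz p1 p2 p3.
  have pmx : pos w m < pos w x.
    case: (ltngtP (pos w x) (pos w m)) => // [p4|[/(index_inj_in xw) xm]].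
      by have := mfirst x xw p1 p4; arith.
    by have := zm z zw (ltn_trans p1 p2) p3 (ltn_trans cx xz); arith.
  have [xd|dx] := ltnP x d.
    by apply: (@bad_increasing w a c x d e) => //; arith.
  have /andP[xm xe] := mid x xw pmx (ltn_trans p2 p3).
  have /andP[zm' ze] := mid z zw (ltn_trans pmx p2) p3.
  have ? : pos w m < pos w z by arith.
  have ? : pos w x < pos w b by arith.
  have ex : e < x by move: xe; have := eq_pos w d x; arith.
  have ? : e < z by arith.
  by exfalso; have := dec x z xw zw; decide_ltn; arith.
move=> x z xw zw cx xz p1 p2 p3 _.
have xm : x < m by apply: leq_trans xz (zm z zw p2 p3 (ltn_trans cx xz)).
have p4 : pos w x < pos w m by arith.
have := sh x xw; decide_ltn.
by have := eq_pos w d x; have := eq_pos w e x; arith.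
Qed.

(** As for [P7], but with [d] before [b]; the column between [d] and [b] has no entry above [d], so
    an ascent there still gives [P1]. *)
Lemma occurs_bad8 (w : seq nat) : is_perm w -> occurs P8 w -> bad w.
Proof.
move=> pw; open_pattern pw P8 => -[|c [|m [|d [|b [|e [|a [|? ?]]]]]]] /= [[]] // _.
case/and5P=> cw mw dw bw /and3P[ew aw _] pp vv sh dec.
split_ands.
have mfirst z : z \in w -> pos w c < pos w z -> pos w z < pos w m -> z <= c.
  move=> zw p1 p2; rewrite leqNgt; apply/negP => cz.
  have ? : pos w z < pos w b by arith.
  have ? : pos w z < pos w d by arith.
  have := sh z zw; have := is_perm_bounds pw zw; decide_ltn; 
  by have := eq_pos w d z; have := eq_pos w e z; have := eq_pos w m z; arith.
have mid z : z \in w -> pos w m < pos w z -> pos w z < pos w d ->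
    (z < m) && ((z <= d) || (e < z)).
  move=> zw p1 p2.
  have ? : pos w c < pos w z by arith.
  have ? : pos w z < pos w b by arith.
  have := sh z zw; have := is_perm_bounds pw zw; decide_ltn; 
  by have := eq_pos w d z; have := eq_pos w e z; have := eq_pos w m z; arith.
have late z : z \in w -> pos w d < pos w z -> pos w z < pos w b -> z < d.
  move=> zw p1 p2.
  have ? : pos w c < pos w z by arith.
  have ? : pos w m < pos w z by arith.
  have := sh z zw; have := is_perm_bounds pw zw; decide_ltn; 
  by have := eq_pos w d z; have := eq_pos w e z; have := eq_pos w m z; arith.
have zm z : z \in w -> pos w c < pos w z -> pos w z < pos w b -> c < z -> z <= m.
  move=> zw p1 p2 cz; case: (ltngtP (pos w z) (pos w m)) => [p3|p3|[/(index_inj_in zw)->]//].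
    by have := mfirst z zw p1 p3; arith.
  case: (ltngtP (pos w z) (pos w d)) => [p4|p4|[/(index_inj_in zw)->]]; last by arith.
    by have /andP[/ltnW] := mid z zw p3 p4.
  by have := late z zw p4 p2; arith.
apply: (@bad_fallback w a b c d e) => //; try arith.
  move=> x z xw zw cx xz p1 p2 p3.
  have pmx : pos w m < pos w x.
    case: (ltngtP (pos w x) (pos w m)) => // [p4|[/(index_inj_in xw) xm]].
      by have := mfirst x xw p1 p4; arith.
    by have := zm z zw (ltn_trans p1 p2) p3 (ltn_trans cx xz); arith.
  have ? : pos w m < pos w z by arith.
  case: (ltngtP (pos w x) (pos w d)) => [p4|p4|[/(index_inj_in xw) xd]]; last first.
  - by have := late z zw; rewrite -xd; arith.
  - have ? := late x xw p4 (ltn_trans p2 p3); have ? := late z zw (ltn_trans p4 p2) p3.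
    by apply: (@bad_increasing w a c x z e) => //; arith.
  have [xd|dx] := ltnP x d.
    by apply: (@bad_increasing w a c x d e) => //; arith.
  have /andP[xm xe] := mid x xw pmx p4.
  have ex : e < x by move: xe; have := eq_pos w d x; arith.
  have p5 : pos w z < pos w d.
    by case: (ltngtP (pos w z) (pos w d)) => // [p5|[/(index_inj_in zw) zd]];
      [have := late z zw|]; arith.
  have /andP[zm' ze] := mid z zw (ltn_trans pmx p2) p5.
  have ? : e < z by arith.
  by exfalso; have := dec x z xw zw; decide_ltn; arith.
move=> x z xw zw cx xz p1 p2 p3 _.
have xm : x < m by apply: leq_trans xz (zm z zw p2 p3 (ltn_trans cx xz)).
have p4 : pos w x < pos w m by arith.
have := sh x xw; decide_ltn.
by have := eq_pos w d x; have := eq_pos w e x; arith.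
Qed.

(** As for [P7], with the boxes of column 0 replaced by the entry [y]: an [x] before [y] has the
    larger [y] between itself and [c], and an [x] between [y] and [c] is below [d] by shading. *)
Lemma occurs_bad9 (w : seq nat) : is_perm w -> occurs P9 w -> bad w.
Proof.
move=> pw; open_pattern pw P9 => -[|y [|c [|m [|b [|d [|e [|a [|? ?]]]]]]]] /= [[]] // _.
case/and5P=> yw cw mw bw /and4P[dw ew aw _] pp vv sh dec.
split_ands.
have mfirst z : z \in w -> pos w c < pos w z -> pos w z < pos w m -> z <= c.
  move=> zw p1 p2; rewrite leqNgt; apply/negP => cz.
  have ? : pos w z < pos w b by arith.
  have ? : pos w y < pos w z by arith.
  have := sh z zw; have := is_perm_bounds pw zw; decide_ltn; have := eq_pos w y z; 
  by have := eq_pos w d z; have := eq_pos w e z; have := eq_pos w m z; arith.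
have mid z : z \in w -> pos w m < pos w z -> pos w z < pos w b ->
    (z < m) && ((z <= d) || (e < z)).
  move=> zw p1 p2.
  have ? : pos w c < pos w z by arith.
  have ? : pos w y < pos w z by arith.
  have := sh z zw; have := is_perm_bounds pw zw; decide_ltn; have := eq_pos w y z; 
  by have := eq_pos w d z; have := eq_pos w e z; have := eq_pos w m z; arith.
have zm z : z \in w -> pos w c < pos w z -> pos w z < pos w b -> c < z -> z <= m.
  move=> zw p1 p2 cz; case: (ltngtP (pos w z) (pos w m)) => [p3|p3|[/(index_inj_in zw)->]//].
    by have := mfirst z zw p1 p3; arith.
  by have /andP[/ltnW] := mid z zw p3 p2.
apply: (@bad_fallback w a b c d e) => //; try arith.
  move=> x z xw zw cx xz p1 p2 p3.
  have pmx : pos w m < pos w x.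
    case: (ltngtP (pos w x) (pos w m)) => // [p4|[/(index_inj_in xw) xm]].
      by have := mfirst x xw p1 p4; arith.
    by have := zm z zw (ltn_trans p1 p2) p3 (ltn_trans cx xz); arith.
  have [xd|dx] := ltnP x d.
    by apply: (@bad_increasing w a c x d e) => //; arith.
  have /andP[xm xe] := mid x xw pmx (ltn_trans p2 p3).
  have /andP[zm' ze] := mid z zw (ltn_trans pmx p2) p3.
  have ? : pos w m < pos w z by arith.
  have ? : pos w x < pos w b by arith.
  have ex : e < x by move: xe; have := eq_pos w d x; arith.
  have ? : e < z by arith.
  by exfalso; have := dec x z xw zw; decide_ltn; arith.
move=> x z xw zw cx xz p1 p2 p3 /inv231Pn/(_ y yw).
have xm : x < m by apply: leq_trans xz (zm z zw p2 p3 (ltn_trans cx xz)).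
have p4 : pos w x < pos w m by arith.
have xy : x < y by arith.
case: (pos_total xw xy) => p5; first by decide_ltn; arith.
move=> _; have := sh x xw; decide_ltn.
by have := eq_pos w d x; have := eq_pos w e x; arith.
Qed.

(** Combines the column between [d] and [b] of [P8] with the hiding entry [y] of [P9]. *)
Lemma occurs_bad10 (w : seq nat) : is_perm w -> occurs P10 w -> bad w.
Proof.
move=> pw; open_pattern pw P10 => -[|y [|c [|m [|d [|b [|e [|a [|? ?]]]]]]]] /= [[]] // _.
case/and5P=> yw cw mw dw /and4P[bw ew aw _] pp vv sh dec.
split_ands.
have mfirst z : z \in w -> pos w c < pos w z -> pos w z < pos w m -> z <= c.
  move=> zw p1 p2; rewrite leqNgt; apply/negP => cz.
  have ? : pos w z < pos w b by arith.
  have ? : pos w z < pos w d by arith.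
  have ? : pos w y < pos w z by arith.
  have := sh z zw; have := is_perm_bounds pw zw; decide_ltn; have := eq_pos w y z; 
  by have := eq_pos w d z; have := eq_pos w e z; have := eq_pos w m z; arith.
have mid z : z \in w -> pos w m < pos w z -> pos w z < pos w d ->
    (z < m) && ((z <= d) || (e < z)).
  move=> zw p1 p2.
  have ? : pos w c < pos w z by arith.
  have ? : pos w z < pos w b by arith.
  have ? : pos w y < pos w z by arith.
  have := sh z zw; have := is_perm_bounds pw zw; decide_ltn; have := eq_pos w y z; 
  by have := eq_pos w d z; have := eq_pos w e z; have := eq_pos w m z; arith.
have late z : z \in w -> pos w d < pos w z -> pos w z < pos w b -> z < d.
  move=> zw p1 p2.
  have ? : pos w c < pos w z by arith.
  have ? : pos w m < pos w z by arith.
  have ? : pos w y < pos w z by arith.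
  have := sh z zw; have := is_perm_bounds pw zw; decide_ltn; have := eq_pos w y z; 
  by have := eq_pos w d z; have := eq_pos w e z; have := eq_pos w m z; arith.
have zm z : z \in w -> pos w c < pos w z -> pos w z < pos w b -> c < z -> z <= m.
  move=> zw p1 p2 cz; case: (ltngtP (pos w z) (pos w m)) => [p3|p3|[/(index_inj_in zw)->]//].
    by have := mfirst z zw p1 p3; arith.
  case: (ltngtP (pos w z) (pos w d)) => [p4|p4|[/(index_inj_in zw)->]]; last by arith.
    by have /andP[/ltnW] := mid z zw p3 p4.
  by have := late z zw p4 p2; arith.
apply: (@bad_fallback w a b c d e) => //; try arith.
  move=> x z xw zw cx xz p1 p2 p3.
  have pmx : pos w m < pos w x.
    case: (ltngtP (pos w x) (pos w m)) => // [p4|[/(index_inj_in xw) xm]].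
      by have := mfirst x xw p1 p4; arith.
    by have := zm z zw (ltn_trans p1 p2) p3 (ltn_trans cx xz); arith.
  have ? : pos w m < pos w z by arith.
  case: (ltngtP (pos w x) (pos w d)) => [p4|p4|[/(index_inj_in xw) xd]]; last first.
  - by have := late z zw; rewrite -xd; arith.
  - have ? := late x xw p4 (ltn_trans p2 p3); have ? := late z zw (ltn_trans p4 p2) p3.
    by apply: (@bad_increasing w a c x z e) => //; arith.
  have [xd|dx] := ltnP x d.
    by apply: (@bad_increasing w a c x d e) => //; arith.
  have /andP[xm xe] := mid x xw pmx p4.
  have ex : e < x by move: xe; have := eq_pos w d x; arith.
  have p5 : pos w z < pos w d.
    by case: (ltngtP (pos w z) (pos w d)) => // [p5|[/(index_inj_in zw) zd]];
      [have := late z zw|]; arith.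
  have /andP[zm' ze] := mid z zw (ltn_trans pmx p2) p5.
  have ? : e < z by arith.
  by exfalso; have := dec x z xw zw; decide_ltn; arith.
move=> x z xw zw cx xz p1 p2 p3 /inv231Pn/(_ y yw).
have xm : x < m by apply: leq_trans xz (zm z zw p2 p3 (ltn_trans cx xz)).
have p4 : pos w x < pos w m by arith.
have xy : x < y by arith.
case: (pos_total xw xy) => p5; first by decide_ltn; arith.
move=> _; have := sh x xw; decide_ltn.
by have := eq_pos w d x; have := eq_pos w e x; arith.
Qed.

(** * Extracting one of the ten patterns from [bad] *)

Ltac build_pattern pw P vs :=
  apply/(occursP pw (isT : is_perm (pat P))); exists vs;
  rewrite /vocc /vbox /vsort /ltn /=; split;
  [by split=> //; repeat (apply/andP; split) | by arith | by arith | |].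

Ltac by_box := repeat (apply/andP; split => //); arith.

(** Each shaded box is refuted by one of four facts about a putative entry in it. *)
Ltac box_contra h1 h2 h3 h4 :=
  repeat (apply/andP; split => //); apply/negP => ?; split_ands;
  first [by move: h1; decide_ltn; arith | by move: h2; decide_ltn; arith
       | by move: h3; decide_ltn; arith | by move: h4; decide_ltn; arith].

(** Converse of [bad_chain]: [e] follows [b] and [c], since otherwise it would witness an excluded
    inversion. The order of [b], [c], [d] then selects the pattern; [c], [d], [b] is impossible
    because [d] would witness [inv231 w c b]. *)
Lemma chain_occurs (w : seq nat) (a b c d e : nat) : is_perm w ->
  a \in w -> b \in w -> c \in w -> d \in w -> e \in w ->
  [/\ a < b, b < c, c < d & d < e] -> pos w d < pos w e -> pos w e < pos w a ->
  ~~ inv231 w d c -> ~~ inv231 w c b ->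
  occurs P1 w \/ occurs P2 w \/ occurs P3 w \/ occurs P4 w \/ occurs P5 w.
Proof.
move=> pw aw bw cw dw ew [ab bc cd de] pde pea /inv231Pn dc /inv231Pn cb.
have pce : pos w c < pos w e.
  by have := dc e ew; case: (pos_total cw (ltn_trans cd de)); arith.
have pbe : pos w b < pos w e.
  by have := cb e ew; case: (pos_total bw (ltn_trans bc (ltn_trans cd de))); arith.
case: (pos_total bw bc) => pbc; case: (pos_total cw cd) => pcd.
- by left; build_pattern pw P1 [:: b; c; d; e; a].
- case: (pos_total bw (ltn_trans bc cd)) => pbd.
    right; left; build_pattern pw P2 [:: b; d; c; e; a] => // x xw.
    by have := dc x xw => ?; by_box.
  right; right; right; left; build_pattern pw P4 [:: d; b; c; e; a] => // x xw.
  by have := dc x xw => ?; by_box.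
- have pbd : pos w b < pos w d.
    by have := cb d dw; case: (pos_total bw (ltn_trans bc cd)); arith.
  right; right; left; build_pattern pw P3 [:: c; b; d; e; a] => // x xw.
  by have := cb x xw => ?; by_box.
- right; right; right; right; build_pattern pw P5 [:: d; c; b; e; a] => // x xw.
  by have := cb x xw => ?; have := dc x xw => ?; by_box.
Qed.

(** Let [y] be the last entry above [c] before [c]. If [y < m], the hypothesis yields a larger entry
    between [y] and [c], against the choice of [y]. *)
Lemma nearest_larger_before (w : seq nat) (c m : nat) : is_perm w ->
  {in w, forall x, c < x -> x < m -> pos w x < pos w c -> inv231 w x c} ->
  {in w, forall x, ~~ [&& pos w x < pos w c, c < x & x < m]} \/
  (exists y, [/\ y \in w, m <= y, pos w y < pos w c &
    {in w, forall x, ~~ [&& pos w y < pos w x, pos w x < pos w c & c < x]}]).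
Proof.
move=> pw K; have [/hasP[x xw /and3P[px cx xm]]|/hasPn no] :=
  boolP (has (fun x => [&& pos w x < pos w c, c < x & x < m]) w); last first.
  by left.
pose Q i := has (fun y => [&& pos w y == i, c < y & pos w y < pos w c]) w.
have exQ : exists i, Q i by exists (pos w x); apply/hasP; exists x; rewrite ?eqxx ?cx.
have ubQ i : Q i -> i <= pos w c by case/hasP=> y _ /and3P[/eqP <- _ /ltnW].
case: (ex_maxnP exQ ubQ) => i /hasP[y yw /and3P[/eqP <- cy py]] ymax.
have near z : z \in w -> ~~ [&& pos w y < pos w z, pos w z < pos w c & c < z].
  move=> zw; apply/negP => /and3P[p1 p2 cz].
  have : Q (pos w z) by apply/hasP; exists z; rewrite ?eqxx ?cz.
  by move/ymax; rewrite leqNgt p1.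
right; exists y; split=> //; rewrite leqNgt; apply/negP => ym.
have /inv231P[z [zw yz p1 p2]] := K y yw cy ym py.
by have := near z zw; rewrite p1 p2 /=; arith.
Qed.

Lemma bad_occurs (w : seq nat) : is_perm w -> bad w ->
  occurs P1 w \/ occurs P2 w \/ occurs P3 w \/ occurs P4 w \/ occurs P5 w \/
  occurs P6 w \/ occurs P7 w \/ occurs P8 w \/ occurs P9 w \/ occurs P10 w.
Proof.
move=> pw [a [b [c [d [[aw bw cw dw] [ab bc cd] /inv231P[e [ew de pde pea]] dc K]]]]].
have [cb|/negbNE/inv231P[z0 [z0w cz0 z01 z02]]] := boolP (~~ inv231 w c b).
  by have := chain_occurs pw aw bw cw dw ew (And4 ab bc cd de) pde pea dc cb; intuition.
have pcb : pos w c < pos w b by arith.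
(* In an ascent, [y] witnesses [inv231 w x b], so the last clause of [bad] asks for an entry between
   [x] and [c], although [x] follows [c]. *)
have decr x y : x \in w -> y \in w -> c < x -> x < y -> pos w c < pos w x ->
    pos w x < pos w y -> pos w y < pos w b -> False.
  move=> xw yw cx xy p1 p2 p3.
  have /inv231P[z [_ _ p4 p5]] : inv231 w x c by apply: K => //; apply/inv231P; exists y.
  by arith.
(* [m] is chosen as the maximum; by [decr] it is also the first entry above [c] after [c]. *)
have [m [mw cm pcm pmb mmax]] : exists m, [/\ m \in w, c < m, pos w c < pos w m,
    pos w m < pos w b & {in w, forall x, pos w c < pos w x -> pos w x < pos w b -> x <= m}].
  pose Q x := [&& x \in w, c < x, pos w c < pos w x & pos w x < pos w b].
  have exQ : exists x, Q x by exists z0; rewrite /Q z0w cz0 z01 z02.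
  have ubQ x : Q x -> x <= size w by case/andP=> /(is_perm_bounds pw)/andP[].
  case: (ex_maxnP exQ ubQ) => m /and4P[mw cm p1 p2] mmax; exists m; split=> // x xw p3 p4.
  have [xc|cx] := leqP x c; first by arith.
  by apply: mmax; rewrite /Q xw cx p3 p4.
have mfirst x : x \in w -> pos w c < pos w x -> pos w x < pos w m -> x <= c.
  move=> xw p1 p2; rewrite leqNgt; apply/negP => cx.
  have xm : x <= m by apply: mmax => //; arith.
  by apply: (decr x m) => //; have := eq_pos w m x; arith.
have pbe : pos w b < pos w e.
  case: (pos_total bw (ltn_trans bc (ltn_trans cd de))) => // peb.
  by move: dc; rewrite K //; apply/inv231P; exists e.
have mmaxN x : x \in w -> ~~ [&& pos w c < pos w x, pos w x < pos w b & m < x].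
  by move=> xw; apply/negP => /and3P[p1 p2]; have := mmax x xw p1 p2; arith.
have mfirstN x : x \in w -> ~~ [&& pos w c < pos w x, pos w x < pos w m & c < x].
  by move=> xw; apply/negP => /and3P[p1 p2]; have := mfirst x xw p1 p2; arith.
case: (ltngtP m e) => [me|em|me]; last by move: pmb; rewrite me; arith.
  have : occurs P6 w; last by intuition.
  build_pattern pw P6 [:: c; m; b; e; a] => // x xw.
  by have H1 := mmaxN x xw; have H2 := mfirstN x xw; box_contra H1 H2 H1 H2.
have K' x : x \in w -> c < x -> x < m -> pos w x < pos w c -> inv231 w x c.
  by move=> xw cx xm px; apply: K => //; apply/inv231P; exists m; split=> //; arith.
(* If some entry between [c] and [b] has value between [c] and [e], the largest such entry replaces
   [d]; otherwise the original [d] is kept. *)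
have [[d' [[dw' cd' de'] pmd' pdb' dmax]]|dno] :
    (exists d', [/\ [/\ d' \in w, c < d' & d' < e], pos w m < pos w d', pos w d' < pos w b &
      {in w, forall x, ~~ [&& pos w m < pos w x, pos w x < pos w b, d' < x & x < e]}]) \/
    {in w, forall x, ~~ [&& pos w c < pos w x, pos w x < pos w b, c < x & x < e]}.
  pose Q x := [&& x \in w, c < x, x < e, pos w c < pos w x & pos w x < pos w b].
  have [/hasP[x _ Qx]|/hasPn no] := boolP (has Q w); last first.
    right=> x xw; apply/negP => /and4P[p1 p2 cx xe].
    by have := no x xw; rewrite /Q xw cx p1 p2 xe.
  left; have exQ : exists x, Q x by exists x.
  have ubQ y : Q y -> y <= e by case/and3P=> _ _ /andP[/ltnW].
  case: (ex_maxnP exQ ubQ) => y /and5P[yw cy ye p1 p2] ymax; exists y; split=> //.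
    case: (ltngtP (pos w m) (pos w y)) => // [p3|[/(index_inj_in mw) my]]; last by arith.
    by have := mfirst y yw p1 p3; arith.
  move=> z zw; apply/negP => /and4P[p3 p4 yz ze].
  have : Q z by rewrite /Q zw (ltn_trans cy yz) ze p4 (ltn_trans pcm p3).
  by move/ymax; rewrite leqNgt yz.
- have lateN x : x \in w -> ~~ [&& pos w d' < pos w x, pos w x < pos w b & d' < x].
    move=> xw; apply/negP => /and3P[p1 p2 dx].
    by apply: (decr d' x) => //; arith.
  have pdb : pos w d' < pos w e by arith.
  case: (nearest_larger_before pw K') => [no|[y [yw my pyc near]]].
    have : occurs P8 w; last by intuition.
    build_pattern pw P8 [:: c; m; d'; b; e; a] => [x xw|x y xw yw].
      have H1 := mmaxN x xw; have H2 := mfirstN x xw; have H3 := lateN x xw.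
      (* [box_contra] takes four facts, so two of the five are paired. *)
      have H4 := conj (dmax x xw) (no x xw); box_contra H1 H2 H3 H4.
    rewrite !orbF => Hx Hy pxy; rewrite leqNgt; apply/negP => xy; split_ands.
    by apply: (decr x y) => //; arith.
  (* [y] is not [m], which comes after [c]. *)
  have {}my : m < y by rewrite ltn_neqAle my andbT; apply: contraTneq pyc => <-; arith.
  have : occurs P10 w; last by intuition.
  build_pattern pw P10 [:: y; c; m; d'; b; e; a] => [x xw|x z xw zw].
    have H1 := mmaxN x xw; have H2 := mfirstN x xw; have H3 := lateN x xw.
    have H4 := conj (dmax x xw) (near x xw); box_contra H1 H2 H3 H4.
  rewrite !orbF => Hx Hz pxz; rewrite leqNgt; apply/negP => xz; split_ands.
  by apply: (decr x z) => //; arith.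
(* If [d] preceded [c], then [m > e > d] would witness [inv231 w d b], hence [inv231 w d c] would
   hold, against [dc]. *)
have pcd : pos w c < pos w d.
  case: (pos_total cw cd) => // pdc; move: dc; rewrite K //.
  by apply/inv231P; exists m; split=> //; arith.
have pbd : pos w b < pos w d.
  case: (pos_total bw (ltn_trans bc cd)) => // pdb.
  by have := dno d dw; rewrite pcd pdb cd de.
case: (nearest_larger_before pw K') => [no|[y [yw my pyc near]]].
  have : occurs P7 w; last by intuition.
  build_pattern pw P7 [:: c; m; b; d; e; a] => [x xw|x y xw yw].
    have H1 := mmaxN x xw; have H2 := mfirstN x xw; have H3 := dno x xw.
    have H4 := no x xw; box_contra H1 H2 H3 H4.
  rewrite !orbF => Hx Hy pxy; rewrite leqNgt; apply/negP => xy; split_ands.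
  by apply: (decr x y) => //; arith.
have {}my : m < y by rewrite ltn_neqAle my andbT; apply: contraTneq pyc => <-; arith.
have : occurs P9 w; last by intuition.
build_pattern pw P9 [:: y; c; m; b; d; e; a] => [x xw|x z xw zw].
  have H1 := mmaxN x xw; have H2 := mfirstN x xw; have H3 := dno x xw.
  have H4 := near x xw; box_contra H1 H2 H3 H4.
rewrite !orbF => Hx Hz pxz; rewrite leqNgt; apply/negP => xz; split_ands.
by apply: (decr x z) => //; arith.
Qed.

Theorem theorem3p9 (pi : seq nat) :
  is_perm pi ->
  (S3 pi = idp (size pi) <->
   avoids P1 pi /\ avoids P2 pi /\ avoids P3 pi /\ avoids P4 pi /\ avoids P5 pi /\
   avoids P6 pi /\ avoids P7 pi /\ avoids P8 pi /\ avoids P9 pi /\ avoids P10 pi).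
Proof.
move=> pw; have nid := S3_not_id pw; split=> [id|av].
  have nbad : ~ bad pi by move/nid; apply.
  do ![split]; move=> occ; apply: nbad.
  - exact: occurs_bad1 occ.
  - exact: occurs_bad2 occ.
  - exact: occurs_bad3 occ.
  - exact: occurs_bad4 occ.
  - exact: occurs_bad5 occ.
  - exact: occurs_bad6 occ.
  - exact: occurs_bad7 occ.
  - exact: occurs_bad8 occ.
  - exact: occurs_bad9 occ.
  - exact: occurs_bad10 occ.
have [//|/eqP/nid/(bad_occurs pw)] := eqVneq (S3 pi) (idp (size pi)).
by rewrite /avoids in av; intuition.
Qed.
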